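(* Let $B$ be a standard one-dimensional Brownian motion, and let $f\colon\mathbb{R}^+\to\mathbb{R}$ be either $1/2$-Hölder continuous on compact intervals or of bounded variation on compact intervals. Then the Hausdorff dimension of $\mathcal{Z}(B-f)=\{t>0:B(t)=f(t)\}$ is at most $1/2$, almost surely.
   Context: $\mathbb{R}^+=[0,\infty)$; $B=(B(t))_{t\ge 0}$ starts at $0$. For a real function $g$ on $\mathbb{R}^+$, $\mathcal{Z}(g)$ denotes the set of zeros of $g$ in $(0,\infty)$. ''$1/2$-Hölder continuous on compact intervals'' means that for each compact interval $K\subset\mathbb{R}^+$ there is a constant $C_K$ with $|f(t)-f(s)|\le C_K|t-s|^{1/2}$ for all $s,t\in K$. *)

(* Defs.v *)
From HB Require Import structures.
From mathcomp Require Export all_boot all_order all_algebra.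
From mathcomp Require Export all_classical all_reals all_analysis.
From mathcomp Require Export measurable_realfun.

Set Implicit Arguments.
Unset Strict Implicit.
Unset Printing Implicit Defensive.

Import Order.TTheory GRing.Theory Num.Theory.
Import numFieldNormedType.Exports.

Local Open Scope classical_set_scope.
Local Open Scope ring_scope.

Section HausdorffDimension.
Context {R : realType}.
Implicit Types (s delta : R) (A E : set R).
Local Open Scope ereal_scope.

(* The diameter of the empty set is [-oo] here. *)
Definition diam E : \bar R :=
  ereal_sup [set `|p.1 - p.2|%:E | p in E `*` E].

(* The empty set contributes 0 for every s, including s = 0 (the library has
   x `^ 0 = 1), so a finite cover can be padded with empty sets. *)
Definition diam_pow s E : \bar R :=
  if E == set0 then 0 else diam E `^ s.

Definition delta_cover delta A (E : (set R)^nat) : Prop :=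
  (forall i, diam (E i) <= delta%:E) /\ A `<=` \bigcup_i E i.

Definition hausdorff_premeasure s delta A : \bar R :=
  ereal_inf [set \sum_(0 <= i <oo) diam_pow s (E i) | E in delta_cover delta A].

Definition hausdorff_measure s A : \bar R :=
  ereal_sup [set hausdorff_premeasure s delta A
            | delta in [set delta : R | (0 < delta)%R]].

Definition hausdorff_dim A : \bar R :=
  ereal_inf [set s%:E | s in
    [set s : R | (0 <= s)%R /\ hausdorff_measure s A = 0]].

End HausdorffDimension.

Section BrownianMotion.
Context {R : realType} {d : measure_display} {T : measurableType d}.
Variable P : probability T R.

Definition mutually_independent n (X : 'I_n -> {RV P >-> R}) : Prop :=
  forall A : 'I_n -> set R, (forall i, measurable (A i)) ->
    P (\bigcap_(i : 'I_n) (X i @^-1` A i)) =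
    (\prod_(i < n) P (X i @^-1` A i))%E.

Definition increment (B : R -> {RV P >-> R}) (s t : R) : {RV P >-> R} :=
  B t \- B s.

(* Times are real numbers; only the variables [B t] with [0 <= t] are
   constrained.  The second argument of [normal_prob] is the standard
   deviation. *)
Record standard_brownian_motion (B : R -> {RV P >-> R}) : Prop := {
  bm_start : {ae P, forall w, B 0 w = 0};
  bm_indep_increments : forall (n : nat) (t : R^nat),
    0 <= t 0%N -> nondecreasing_seq t ->
    mutually_independent (fun i : 'I_n => increment B (t i) (t i.+1));
  bm_normal_increments : forall s t : R, 0 <= s -> s < t ->
    forall A : set R, measurable A ->
    distribution P (increment B s t) A = normal_prob 0 (Num.sqrt (t - s)) A;
  bm_continuous_paths :
    {ae P, forall w, {within `[0, +oo[, continuous (fun t : R => B t w : R)}} }.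

End BrownianMotion.

Section FunctionsOnHalfLine.
Context {R : realType}.
Implicit Types (f g : R -> R).

Definition half_hoelder_on_compacts f : Prop :=
  forall a b : R, 0 <= a -> a <= b ->
    exists C : R, forall s t : R, s \in `[a, b] -> t \in `[a, b] ->
      `|f t - f s| <= C * `|t - s| `^ 2^-1.

Definition bounded_variation_on_compacts f : Prop :=
  forall a b : R, 0 <= a -> a <= b -> bounded_variation a b f.

Definition zeros g : set R := [set t | 0 < t /\ g t = 0].

End FunctionsOnHalfLine.

(* Main.v *)
(** Fix s > 1/2 and choose q > 1/sqrt 2 with 2 q 2^(-s) < 1.  By the Gaussian
    tail bound and Borel-Cantelli, almost surely every increment of B over a
    dyadic interval of length 2^(-n) in a bounded range is at most q^n for large
    n; by chaining, B oscillates by at most q^n / (1 - q) on such an interval.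
    A zero of B - f in [k/2^n, (k+1)/2^n) therefore forces
    |B(k/2^n) - f(k/2^n)| <= v_k + q^n / (1 - q), where v_k bounds the oscillation
    of f.  Away from 0 this has probability O(v_k + q^n), and in both cases of
    the theorem the v_k add up to O(2^(n/2)), so the expected number of such
    intervals is O((2q)^n).  By Markov's inequality and Borel-Cantelli these
    covers have s-dimensional size tending to 0, so the zero set has
    s-dimensional Hausdorff measure 0. *)
Require Import Defs.
From mathcomp Require Import ring lra.

Set Implicit Arguments.
Unset Strict Implicit.
Unset Printing Implicit Defensive.

Import Order.TTheory GRing.Theory Num.Theory.
Import numFieldNormedType.Exports.
Local Open Scope classical_set_scope.
Local Open Scope ring_scope.

(** * Null sets for the Hausdorff measure, through covers of small total size *)

Section HausdorffNull.
Context {R : realType}.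
Implicit Types (s delta eps : R) (A : set R).

(** Vanishing of the [s]-dimensional measure, with the supremum over [delta] and the infimum over
    covers unfolded into quantifiers. *)
Definition small_covers s A : Prop := forall delta eps, 0 < delta -> 0 < eps ->
  exists2 E : (set R)^nat, delta_cover delta A E &
    (\sum_(0 <= i <oo) diam_pow s (E i) <= eps%:E)%E.

Lemma diam_pow_ge0 s (E : set R) : (0 <= diam_pow s E)%E.
Proof. by rewrite /diam_pow; case: ifP => // _; exact: poweR_ge0. Qed.

Lemma diam_pow_set0 s : diam_pow s (set0 : set R) = 0%E.
Proof. by rewrite /diam_pow eqxx. Qed.

Lemma diam_le (E : set R) r :
  (forall x y, E x -> E y -> `|x - y| <= r) -> (diam E <= r%:E)%E.
Proof.
move=> Er; apply: ge_ereal_sup => _ [[x y] [/= Ex Ey] <-].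
by rewrite lee_fin; exact: Er.
Qed.

Lemma diam_pow_le s (E : set R) r : 0 <= s ->
  (diam E <= r%:E)%E -> (diam_pow s E <= (r `^ s)%:E)%E.
Proof.
move=> s0 Er; rewrite /diam_pow; case: ifPn => [_|/set0P[x Ex]].
  by rewrite lee_fin powR_ge0.
have d0 : (0 <= diam E)%E.
  apply: ereal_sup_ubound; exists (x, x) => //=.
  by rewrite subrr normr0.
case: (diam E) d0 Er => [x'| |]//; rewrite !lee_fin => d0 Er.
by apply: ge0_ler_powR => //; rewrite nnegrE ?(le_trans d0).
Qed.

Lemma hausdorff_measure_small_covers s A :
  small_covers s A -> hausdorff_measure s A = 0%E.
Proof.
move=> sA; apply/eqP; rewrite eq_le; apply/andP; split.
  apply: ge_ereal_sup => _ [delta /= delta0 <-].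
  apply/lee_addgt0Pr => e e0; rewrite add0e.
  have [E cE Ee] := sA _ _ delta0 e0.
  by apply: ge_ereal_inf; exists (\sum_(0 <= i <oo) diam_pow s (E i))%E => //; exists E.
apply: (@le_trans _ _ (hausdorff_premeasure s 1 A)); last first.
  by apply: ereal_sup_ubound; exists 1 => //=.
apply: le_ereal_inf_tmp => _ [E _ <-].
by apply: nneseries_ge0 => n _ _; exact: diam_pow_ge0.
Qed.

(** Cover the [p]-th set with total size [eps / 2 ^ p.+1], then merge the double family of covers
    into one sequence along a bijection from [nat] to [nat * nat]. *)
Lemma small_covers_bigcup s (A : (set R)^nat) :
  (forall p, small_covers s (A p)) -> small_covers s (\bigcup_p A p).
Proof.
move=> sA delta eps delta0 eps0.
have epsp p : 0 < eps / (2 ^ p.+1)%:R by rewrite divr_gt0// ltr0n expn_gt0.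
have /choice[E EP] : forall p, exists E : (set R)^nat, delta_cover delta (A p) E /\
    (\sum_(0 <= i <oo) diam_pow s (E i) <= (eps / (2 ^ p.+1)%:R)%:E)%E.
  by move=> p; have [E] := sA p _ _ delta0 (epsp p); exists E.
have /card_esym/card_set_bijP[e be] := card_nat2.
exists (fun n => E (e n).1 (e n).2).
  split=> [i|x [p _ Apx]]; first by have [[]] := EP (e i).1.
  have [[_ /(_ _ Apx)[j _ Ej]] _] := EP p.
  have [_ _ /(_ (p, j) I)[i _ ei]] := be.
  by exists i => //; rewrite ei.
(* All terms are nonnegative, so the series is an unordered sum, which may be reindexed and then
   summed row by row. *)
rewrite nneseries_esumT; last by move=> n; exact: diam_pow_ge0.
rewrite -(@reindex_esum _ _ _ _ _ _ (fun k => diam_pow s (E k.1 k.2)) be).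
rewrite (_ : [set: nat * nat] = [set: nat] `*`` (fun=> [set: nat])); last first.
  by apply/seteqP; split.
rewrite -(@esum_esum _ _ _ _ _ (fun i j => diam_pow s (E i j))); last first.
  by move=> *; exact: diam_pow_ge0.
rewrite -nneseries_esumT; last by move=> n; apply: esum_ge0 => *; exact: diam_pow_ge0.
apply: le_trans (epsilon_trick0 xpredT (ltW eps0)).
apply: lee_nneseries => [n _ _|p _]; first by apply: esum_ge0 => *; exact: diam_pow_ge0.
apply: le_trans (proj2 (EP p)); rewrite nneseries_esumT// => n.
exact: diam_pow_ge0.
Qed.

(** Only the exponents [a + j.+1%:R^-1] enter: being countably many, they can share one null
    event. *)
Lemma hausdorff_dim_le A (a : R) : 0 <= a ->
  (forall j : nat, hausdorff_measure (a + j.+1%:R^-1) A = 0%E) ->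
  (hausdorff_dim A <= a%:E)%E.
Proof.
move=> a0 H; apply/lee_addgt0Pr => e e0.
have /ltr_add_invr[j] : 0 < e by [].
rewrite add0r => je.
apply: ge_ereal_inf; exists (a + j.+1%:R^-1)%:E.
  by exists (a + j.+1%:R^-1) => //=; split; rewrite ?addr_ge0.
by rewrite -EFinD lee_fin lerD2l ltW.
Qed.

Lemma nneseries_diam_pow_le s (r : R) K (sel : nat -> bool) (E : (set R)^nat) :
  0 <= s -> (forall k, (diam (E k) <= r%:E)%E) ->
  (forall k, ~~ ((k < K)%N && sel k) -> E k = set0) ->
  (\sum_(0 <= i <oo) diam_pow s (E i) <=
     (\sum_(k < K) (sel k)%:R * r `^ s)%:E)%E.
Proof.
move=> s0 Er E0.
rewrite (nneseries_split 0 K); last by move=> *; exact: diam_pow_ge0.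
rewrite add0n eseries0; last first.
  by move=> i Ki _; rewrite E0 ?diam_pow_set0// ltnNge Ki.
rewrite adde0 big_mkord -sumEFin; apply: lee_sum => k _.
case: (boolP (sel k)) => [_|nsel]; first by rewrite mul1r diam_pow_le.
by rewrite E0 ?diam_pow_set0 ?mul0r// (negbTE nsel) andbF.
Qed.

End HausdorffNull.

(** * Small-ball and tail bounds for centred Gaussian laws *)

Section NormalBounds.
Context {R : realType}.
Implicit Types (s l r c : R).

Lemma normal_peak_le s : 0 < s -> normal_peak s <= s^-1.
Proof.
move=> s0; rewrite /normal_peak lef_pV2 ?posrE//; last first.
  by rewrite sqrtr_gt0 pmulrn_lgt0// mulr_gt0 ?exprn_gt0// pi_gt0.
rewrite -{1}(ger0_norm (ltW s0)) -sqrtr_sqr.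
rewrite ler_wsqrtr// -mulrnAr ler_peMr ?sqr_ge0//.
by have := @pi_ge2 R; rewrite mulr2n; lra.
Qed.

Lemma normr_sub_le_itv c r : [set x | `|x - c| <= r] = `[c - r, c + r]%classic.
Proof. by apply/seteqP; split=> x /=; rewrite in_itv/= ler_distl. Qed.

(** The density never exceeds its peak, which is at most [s^-1], and the ball has length [2 * r].
    The centre is arbitrary because it will be a value of [f]. *)
Lemma normal_prob_ball_le s c r : 0 < s -> 0 <= r ->
  (normal_prob 0 s [set x | (`|x - c| <= r)%R] <= (2 * r / s)%:E)%E.
Proof.
move=> s0 r0; rewrite normr_sub_le_itv.
apply: (@le_trans _ _ (\int[lebesgue_measure]_(x in `[(c - r)%R, (c + r)%R]) (s^-1)%:E))%E.
  apply: ge0_le_integral => //=.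
  - by move=> x _; rewrite lee_fin normal_pdf_ge0.
  - by apply/measurable_funTS/measurableT_comp => //; exact: measurable_normal_pdf.
  - move=> x _; rewrite lee_fin; apply: le_trans (normal_peak_le s0).
    by apply: normal_pdf_ub; rewrite gt_eqF.
rewrite integral_cst//= lebesgue_measure_itv/=; case: ifP => _.
  rewrite -EFinD -EFinM lee_fin le_eqVlt; apply/orP; left; apply/eqP; ring.
by rewrite mule0 lee_fin divr_ge0// ?mulr_ge0// ltW.
Qed.

Lemma measurable_normr_gt l : measurable [set x : R | l < `|x|].
Proof.
rewrite (_ : [set x | _] = Num.norm @^-1` `]l, +oo[%classic); last first.
  by apply/seteqP; split=> x /=; rewrite in_itv/= andbT.
by rewrite -[X in measurable X]setTI; exact: normr_measurable.
Qed.

(* For |x| > l the density of N(0, s^2) is at most 2 exp(-l^2/4s^2) times that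
   of N(0, (2s)^2), whose total mass is 1. *)
Lemma normal_prob_tail_le s l : 0 < s -> 0 <= l ->
  (normal_prob 0 s [set x | (l < `|x|)%R] <=
     (2 * expR (- (l ^+ 2 / (4 * s ^+ 2))))%:E)%E.
Proof.
move=> s0 l0; set k := 2 * _.
have k0 : 0 <= k by rewrite mulr_ge0// expR_ge0.
have s20 : 0 < 2 * s by rewrite mulr_gt0.
apply: (@le_trans _ _ (\int[lebesgue_measure]_x (k * normal_pdf 0 (2 * s) x)%:E))%E; last first.
  under eq_integral do rewrite EFinM.
  rewrite ge0_integralZl//=.
  - by rewrite integral_normal_pdf mule1.
  - by apply/measurableT_comp => //; exact: measurable_normal_pdf.
  - by move=> x _; rewrite lee_fin normal_pdf_ge0.
apply: (@le_trans _ _ (\int[lebesgue_measure]_(x in [set x | (l < `|x|)%R]) (k * normal_pdf 0 (2 * s) x)%:E))%E; last first.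
  apply: ge0_subset_integral => //=.
  - exact: measurable_normr_gt.
  - apply/measurableT_comp => //; apply/measurable_funM => //.
    exact: measurable_normal_pdf.
  - by move=> x _; rewrite lee_fin mulr_ge0 ?normal_pdf_ge0.
apply: ge0_le_integral => //=.
- exact: measurable_normr_gt.
- by move=> x _; rewrite lee_fin normal_pdf_ge0.
- by apply/measurable_funTS/measurableT_comp => //; exact: measurable_normal_pdf.
- apply/measurable_funTS/measurableT_comp => //; apply/measurable_funM => //.
  exact: measurable_normal_pdf.
move=> x lx; rewrite lee_fin !normal_pdfE ?gt_eqF//.
(* Doubling the deviation halves the peak, whence the factor 2 in [k]. *)
have -> : normal_peak s = 2 * normal_peak (2 * s).
  rewrite /normal_peak (_ : (2 * s) ^+ 2 * pi *+ 2 = 2 ^+ 2 * (s ^+ 2 * pi *+ 2)); last by ring.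
  by rewrite (sqrtrM _ (sqr_ge0 2)) sqrtr_sqr ger0_norm// invfM mulrA mulfV// mul1r.
have p0 := normal_peak_ge0 (2 * s).
rewrite /k -!mulrA ler_pM2l// mulrCA ler_wpM2l//.
rewrite /normal_fun -expRD ler_expR !subr0.
have lx2 : l ^+ 2 <= x ^+ 2.
  by rewrite -(real_normK (num_real x)) ler_sqr ?nnegrE// ltW.
rewrite -subr_ge0.
(* The exponents differ by [x^2 / 2s^2 - x^2 / 8s^2 - l^2 / 4s^2], that is [(3x^2 - 2l^2) / 8s^2],
   nonnegative since [l^2 <= x^2]. *)
rewrite (_ : _ - _ = ((x ^+ 2 - l ^+ 2) * 2 + x ^+ 2) * (8 * s ^+ 2)^-1); last first.
  by field; rewrite gt_eqF.
have a0 : 0 <= (x ^+ 2 - l ^+ 2) * 2 + x ^+ 2 by have := sqr_ge0 x; lra.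
by apply: mulr_ge0 => //; rewrite invr_ge0 mulr_ge0// sqr_ge0.
Qed.

End NormalBounds.

(** * Dyadic points and the chaining bound *)

Section Chaining.
Context {R : realType}.
Implicit Types (b : R -> R) (q t : R) (m n k : nat).

Definition dyadic n k : R := k%:R / 2 ^+ n.

Lemma exp2_gt0 n : 0 < 2 ^+ n :> R. Proof. by rewrite exprn_gt0. Qed.

Lemma dyadic_ge0 n k : 0 <= dyadic n k.
Proof. by rewrite divr_ge0// ltW// exp2_gt0. Qed.

Lemma dyadic_double n k : dyadic n.+1 k.*2 = dyadic n k.
Proof.
rewrite /dyadic -muln2 natrM exprS; field.
by rewrite gt_eqF// exp2_gt0.
Qed.

Lemma dyadic_succ n k : dyadic n k.+1 = dyadic n k + (2 ^+ n)^-1.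
Proof. by rewrite /dyadic -natr1 mulrDl mul1r. Qed.

Lemma exp2V_lt e : 0 < e -> exists n, (2 ^+ n)^-1 < e :> R.
Proof.
move=> e0; have [n ne] := ltr_add_invr e0; exists n.+1; move: ne; rewrite add0r.
apply: le_lt_trans; rewrite lef_pV2 ?posrE ?exp2_gt0//.
by rewrite -natrX ler_nat ltnW// ltn_expl.
Qed.

Definition dyadic_index n t : nat := Num.truncn (t * 2 ^+ n).

Lemma dyadic_indexP n t : 0 <= t ->
  dyadic n (dyadic_index n t) <= t < dyadic n (dyadic_index n t).+1.
Proof.
move=> t0; have t20 : 0 <= t * 2 ^+ n by rewrite mulr_ge0// ltW// exp2_gt0.
by rewrite /dyadic ler_pdivrMr ?ltr_pdivlMr ?exp2_gt0// truncn_itv.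
Qed.

Lemma dyadic_index_uniq n t k : dyadic n k <= t < dyadic n k.+1 ->
  dyadic_index n t = k.
Proof.
by rewrite /dyadic ler_pdivrMr ?ltr_pdivlMr ?exp2_gt0// => /truncn_def.
Qed.

Lemma dyadic_index_lt n t N : 0 <= t -> t < N%:R -> (dyadic_index n t < N * 2 ^ n)%N.
Proof.
move=> t0 tN; rewrite -(ltr_nat R); have /andP[+ _] := dyadic_indexP n t0.
rewrite /dyadic ler_pdivrMr ?exp2_gt0// => /le_lt_trans; apply.
by rewrite natrM natrX ltr_pM2r ?exp2_gt0.
Qed.

Lemma dyadic_index_succ n t : 0 <= t ->
  dyadic_index n.+1 t = (dyadic_index n t).*2 \/
  dyadic_index n.+1 t = (dyadic_index n t).*2.+1.
Proof.
move=> t0; have /andP[le1 lt1] := dyadic_indexP n t0.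
set k := dyadic_index n t in le1 lt1 *.
have [lt2|le2] := ltP t (dyadic n.+1 k.*2.+1); [left|right].
  by apply: dyadic_index_uniq; rewrite lt2 dyadic_double le1.
apply: dyadic_index_uniq; rewrite le2/=.
by rewrite -[X in dyadic _ X]/(k.+1).*2 dyadic_double.
Qed.

(* t is the limit of the dyadic points of index [dyadic_index m t]; two
   successive ones coincide or are neighbours at the finer level. *)
Lemma chaining b q M N : 0 < q -> q < 1 ->
  {within `[0, +oo[, continuous b} ->
  (forall m k, (M <= m)%N -> (k < N * 2 ^ m)%N ->
    `|b (dyadic m k.+1) - b (dyadic m k)| <= q ^+ m) ->
  forall n t, (M <= n)%N -> 0 <= t -> t < N%:R ->
    `|b t - b (dyadic n (dyadic_index n t))| <= q ^+ n / (1 - q).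
Proof.
move=> q0 q1 cb incr n t Mn t0 tN.
have q10 : 0 < 1 - q by rewrite subr_gt0.
pose u m := b (dyadic m (dyadic_index m t)).
have ustep m : (M <= m)%N -> `|u m.+1 - u m| <= q ^+ m.+1.
  move=> Mm; rewrite /u; case: (dyadic_index_succ m t0) => ->.
    by rewrite dyadic_double subrr normr0 exprn_ge0 ?ltW.
  rewrite -[in X in _ - X]dyadic_double; apply: incr; first exact: leqW.
  by rewrite expnS mulnCA -mul2n ltn_pmul2l// dyadic_index_lt.
(* The right side is the geometric sum of the powers [n] to [n + j - 1], one power coarser than what
   [ustep] gives. *)
have usum j : `|u (n + j)%N - u n| <= (q ^+ n - q ^+ (n + j)) / (1 - q).
  elim: j => [|j IH]; first by rewrite addn0 !subrr normr0 mul0r.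
  have := ustep (n + j)%N (leq_trans Mn (leq_addr _ _)); rewrite addnS => us.
  have -> : u (n + j).+1 - u n = (u (n + j).+1 - u (n + j)%N) + (u (n + j)%N - u n).
    by rewrite addrA subrK.
  apply: (le_trans (ler_normD _ _)); apply: (le_trans (lerD us IH)).
  have p0 : 0 <= q ^+ (n + j) by rewrite exprn_ge0 ?ltW.
  rewrite -subr_ge0 (_ : _ - _ = q ^+ (n + j) * (1 - q)); last first.
    by rewrite exprS; field; rewrite gt_eqF.
  by apply: mulr_ge0 => //; exact: ltW.
(* By continuity at [t], [u (n + j)] is within [e] of [b t] once [j] is large. *)
apply/ler_addgt0Pr => e e0.
have /subspace_continuousP/(_ t) := cb; rewrite /= in_itv/= andbT => /(_ t0).
move=> /cvgrPdist_le/(_ _ e0); rewrite near_withinE => /nbhs_ballP[d /= d0 bd].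
have [j jd] := exp2V_lt d0.
have njd : (2 ^+ (n + j))^-1 < d.
  apply: le_lt_trans jd; rewrite lef_pV2 ?posrE ?exp2_gt0//.
  by rewrite ler_weXn2l// ?leq_addl// ler1n.
have /andP[le1] := dyadic_indexP (n + j) t0; rewrite dyadic_succ => lt1.
have ue : `|b t - u (n + j)%N| <= e.
  apply: bd; last by rewrite in_itv/= andbT dyadic_ge0.
  by rewrite /ball/= ger0_norm ?subr_ge0//; lra.
rewrite (_ : _ - _ = (b t - u (n + j)%N) + (u (n + j)%N - u n)); last first.
  by rewrite addrA subrK.
apply: (le_trans (ler_normD _ _)); rewrite [leRHS]addrC; apply: lerD => //.
apply: (le_trans (usum j)); rewrite ler_pM2r ?invr_gt0//.
by rewrite gerBl exprn_ge0 ?ltW.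
Qed.

End Chaining.

(** * Oscillation of [f] on dyadic intervals: both regularity assumptions give a sum of order
    [2^(n/2)] *)

Section Oscillation.
Context {R : realType}.
Implicit Types (f : R -> R) (N n k : nat).

Definition dyadic_osc_bound f N n (v : nat -> R) : Prop :=
  forall k t, (k < N * 2 ^ n)%N -> dyadic n k <= t < dyadic n k.+1 ->
    `|f t - f (dyadic n k)| <= v k.

Lemma sqrt2X n : Num.sqrt (2 ^+ n) = Num.sqrt 2 ^+ n :> R.
Proof.
elim: n => [|n IH]; first by rewrite !expr0 sqrtr1.
by rewrite !exprS sqrtrM// IH.
Qed.

Lemma dyadic_le n k k' : (k <= k')%N -> dyadic n k <= dyadic n k' :> R.
Proof. by move=> kk'; rewrite /dyadic ler_pM2r ?invr_gt0 ?exp2_gt0// ler_nat. Qed.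

(** Each of the [N * 2 ^ n] intervals has length [2^(-n)], hence oscillation at most
    [C * 2^(-n/2)]. *)
Lemma half_hoelder_dyadic_osc f N : half_hoelder_on_compacts f ->
  exists2 C, 0 <= C & forall n, exists v : nat -> R,
  [/\ forall k, 0 <= v k, dyadic_osc_bound f N n v &
      \sum_(k < N * 2 ^ n) v k <= C * Num.sqrt 2 ^+ n].
Proof.
move=> /(_ 0 N%:R (lexx _) (ler0n _ _))[C0 fC].
(* For [N = 0] the interval is a point and [C0] could be negative. *)
pose C := Num.max C0 0; have C_ge0 : 0 <= C by rewrite le_max lexx orbT.
exists (N%:R * C); first by rewrite mulr_ge0.
move=> n; exists (fun=> C / Num.sqrt 2 ^+ n).
have s0 : 0 < Num.sqrt 2 ^+ n :> R by rewrite exprn_gt0// sqrtr_gt0.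
split.
- by move=> k; rewrite divr_ge0// ltW.
- move=> k t kN /andP[kt tk].
  have kN' : dyadic n k.+1 <= N%:R :> R.
    have := dyadic_le n kN; move=> /le_trans; apply.
    by rewrite /dyadic natrM natrX mulfK// gt_eqF// exp2_gt0.
  have dk0 := @dyadic_ge0 R n k.
  apply: (@le_trans _ _ (C * `|t - dyadic n k| `^ 2^-1)).
    apply: (@le_trans _ _ (C0 * `|t - dyadic n k| `^ 2^-1)).
      by apply: fC; rewrite in_itv/=; apply/andP; split; lra.
    by rewrite ler_wpM2r ?powR_ge0// le_max lexx.
  rewrite ler_wpM2l// powR12_sqrt// ger0_norm ?subr_ge0//.
  rewrite -sqrt2X -(sqrtrV (ltW (exp2_gt0 n))) ler_wsqrtr//.
  by move: tk; rewrite dyadic_succ; lra.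
- rewrite sumr_const card_ord -(mulr_natl _ (N * 2 ^ n)) natrM natrX.
  rewrite -{1}[2]sqr_sqrtr// exprAC le_eqVlt; apply/orP; left; apply/eqP.
  by field; rewrite gt_eqF.
Qed.

(** Take for [v k] the variation over the [k]-th interval. By additivity these sum to the variation
    over [[0, N]], a bound free of [n], and [Num.sqrt 2 ^+ n >= 1]. *)
Lemma bounded_variation_dyadic_osc f N : bounded_variation_on_compacts f ->
  exists2 C, 0 <= C & forall n, exists v : nat -> R,
  [/\ forall k, 0 <= v k, dyadic_osc_bound f N n v &
      \sum_(k < N * 2 ^ n) v k <= C * Num.sqrt 2 ^+ n].
Proof.
move=> bvf.
have tvfin a b : 0 <= a -> a <= b -> total_variation a b f \is a fin_num.
  by move=> a0 ab; apply/bounded_variationP => //; exact: bvf.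
have tv0 a b : a <= b -> 0 <= fine (total_variation a b f).
  by move=> ab; apply: fine_ge0; exact: total_variation_ge0.
exists (fine (total_variation 0 N%:R f)); first exact: tv0.
move=> n; exists (fun k => fine (total_variation (dyadic n k) (dyadic n k.+1) f)).
split=> [k|k t kN /andP[kt tk]|].
- by apply: tv0; exact: dyadic_le.
- have d0 := @dyadic_ge0 R n k.
  rewrite -lee_fin fineK ?tvfin ?dyadic_le//.
  rewrite (total_variationD f kt (ltW tk)).
  apply: (le_trans (total_variation_ge f kt)).
  by rewrite leeDl// total_variation_ge0// ltW.
have sumE K : \sum_(k < K) fine (total_variation (dyadic n k) (dyadic n k.+1) f) =
    fine (total_variation 0 (dyadic n K) f).
  elim: K => [|K IH]; first by rewrite big_ord0 /dyadic mul0r total_variationxx.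
  rewrite big_ord_recr/= IH (@total_variationD _ 0 (dyadic n K.+1) (dyadic n K)).
  - by rewrite fineD// tvfin ?dyadic_ge0 ?dyadic_le.
  - exact: dyadic_ge0.
  - exact: dyadic_le.
rewrite sumE /dyadic natrM natrX mulfK ?gt_eqF ?exp2_gt0// ler_peMr ?tv0//.
by rewrite exprn_ege1// -[leLHS]sqrtr1 ler_wsqrtr// ler1n.
Qed.

End Oscillation.

(** * Geometric Borel-Cantelli and Markov estimates *)

Section BorelCantelli.
Context {R : realType}.

Lemma exprn_eventually_lt (z e : R) : 0 <= z -> z < 1 -> 0 < e ->
  exists M, forall n, (M <= n)%N -> z ^+ n < e.
Proof.
move=> z0 z1 e0.
have := @cvg_geometric R 1 z; rewrite ger0_norm// => /(_ z1)/cvgrPdist_lt/(_ _ e0).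
move=> [M _ MP]; exists M => n /MP /=.
by rewrite sub0r normrN mul1r ger0_norm// exprn_ge0.
Qed.

(** Choose [J] with [r ^+ J > 4]. For [x = r ^+ m / 4], the bound [expR x >= x ^+ J / J!] makes
    [expR (- x)] at most a constant times [4^(-m)], which absorbs [2 ^+ m]. *)
Lemma exp2_mul_expRN_geometric (r : R) : 1 < r -> exists2 C, 0 <= C &
  forall m, 2 ^+ m * expR (- (r ^+ m / 4)) <= C * 2^-1 ^+ m.
Proof.
move=> r1; have r0 : 0 < r by lra.
have [|||J0 /(_ _ (leqnSn J0))] := @exprn_eventually_lt r^-1 4^-1.
- by rewrite invr_ge0 ltW.
- by rewrite invf_lt1.
- by rewrite invr_gt0.
set J := J0.+1; rewrite exprVn ltf_pV2 ?posrE ?exprn_gt0// => rJ.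
exists (J`!%:R * 4 ^+ J); first by rewrite mulr_ge0// exprn_ge0.
move=> m; set x := r ^+ m / 4.
have x0 : 0 < x by rewrite divr_gt0 ?exprn_gt0.
have f0 : 0 < J`!%:R :> R by rewrite ltr0n fact_gt0.
have fx : x ^+ J / J`!%:R <= expR x.
  by have := expR_ge1Dxn J0 (ltW x0); apply: le_trans; rewrite lerDr.
have xJ : 4 ^+ m / 4 ^+ J <= x ^+ J.
  rewrite /x expr_div_n ler_pM2r ?invr_gt0 ?exprn_gt0// exprAC.
  by apply: lerXn2r; rewrite ?nnegrE ?exprn_ge0 ?ltW.
have c0 : 0 < 4 ^+ m / 4 ^+ J / J`!%:R :> R by rewrite !divr_gt0 ?exprn_gt0.
have le1 : expR (- x) <= (4 ^+ m / 4 ^+ J / J`!%:R)^-1.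
  rewrite expRN lef_pV2 ?posrE ?expR_gt0//; apply: le_trans fx.
  by rewrite ler_pM2r// invr_gt0.
apply: (le_trans (ler_wpM2l _ le1)); first by rewrite exprn_ge0.
have -> : 4 ^+ m = 2 ^+ m * 2 ^+ m :> R by rewrite -exprMn; congr (_ ^+ _); ring.
have p0 : 2 ^+ m != 0 :> R by rewrite gt_eqF// exprn_gt0.
have q0 : 4 ^+ J != 0 :> R by rewrite gt_eqF// exprn_gt0.
rewrite exprVn le_eqVlt; apply/orP; left; apply/eqP; field.
by rewrite p0 q0 gt_eqF.
Qed.

Context {d : measure_display} {T : measurableType d}.
Variable P : probability T R.

(** Borel-Cantelli: the probabilities sum to at most [C / (1 - z)], so the limsup set is null. *)
Lemma ae_eventually_notin (F : (set T)^nat) (C z : R) : 0 <= C -> 0 < z -> z < 1 ->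
  (forall n, measurable (F n)) -> (forall n, (P (F n) <= (C * z ^+ n)%:E)%E) ->
  {ae P, forall w, exists M, forall n, (M <= n)%N -> ~ F n w}.
Proof.
move=> C0 z0 z1 mF PF.
have mL : measurable (lim_sup_set F).
  by apply: bigcap_measurable => // k _; apply: bigcup_measurable.
have PL : P (lim_sup_set F) = 0%E.
  apply: lim_sup_set_cvg0 => //.
  apply: (@le_lt_trans _ _ (C * (1 - z)^-1)%:E); last exact: ltry.
  apply: lime_le; first by apply: is_cvg_nneseries => n _ _; exact: measure_ge0.
  apply: nearW => n; rewrite big_mkord.
  apply: (@le_trans _ _ (\sum_(i < n) (C * z ^+ i)%:E)%E); first by apply: lee_sum => i _; exact: PF.
  rewrite sumEFin lee_fin; apply: le_trans (@geometric_le_lim R n C z C0 z0 _).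
    by rewrite /series/= big_mkord.
  by rewrite ger0_norm// ltW.
exists (lim_sup_set F); split => // w /= nw M _.
apply: contrapT => nF; apply: nw; exists M => n Mn Fn; apply: nF.
by exists n.
Qed.

(** Markov's inequality for the number of events that occur, whose expectation is the sum of the
    probabilities. *)
Lemma count_markov K (G : (set T)^nat) (l : R) : 0 <= l ->
  (forall k, measurable (G k)) ->
  measurable [set w | l <= \sum_(k < K) (\1_(G k) w : R)] /\
  (l%:E * P [set w | (l <= \sum_(k < K) \1_(G k) w)%R] <= \sum_(k < K) P (G k))%E.
Proof.
move=> l0 mG; set H := [set w | _].
have mS : measurable_fun setT (fun w => \sum_(k < K) (\1_(G k) w : R)).
  by apply: measurable_sum => k; exact: measurable_indic.
have mH : measurable H.
  rewrite (_ : H = (fun w => \sum_(k < K) (\1_(G k) w : R)) @^-1` `[l, +oo[%classic).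
    by rewrite -[X in measurable X]setTI; exact: mS.
  by apply/seteqP; split=> w /=; rewrite in_itv/= andbT.
split=> //.
have -> : (\sum_(k < K) P (G k) = \int[P]_w (\sum_(k < K) (\1_(G k) w)%:E))%E.
  rewrite ge0_integral_sum//; last first.
    by move=> k; apply/measurableT_comp => //; exact: measurable_indic.
  by apply: eq_bigr => k _; rewrite integral_indic// setIT.
rewrite -{1}(setIT H) -integral_indic// -ge0_integralZl//; last first.
  by apply/measurableT_comp => //; exact: measurable_indic.
apply: ge0_le_integral => //=.
- by move=> w _; rewrite -EFinM lee_fin mulr_ge0.
- by apply: measurable_funeM; apply/measurableT_comp => //; exact: measurable_indic.
- apply: emeasurable_sum => k; apply/measurableT_comp => //; exact: measurable_indic.
move=> w _; rewrite sumEFin -EFinM lee_fin indicE.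
have [|_] := boolP (w \in H); first by rewrite inE mulr1.
by rewrite mulr0 sumr_ge0.
Qed.

End BorelCantelli.

(** * Almost sure dyadic estimates for Brownian motion *)

Section BrownianZeros.
Context {R : realType}.

Lemma exists_modulus_exponent (s : R) : 2^-1 < s ->
  exists q : R, [/\ 0 < q, q < 1, 1 < 2 * q ^+ 2 & 2 * q * 2 `^ (- s) < 1].
Proof.
move=> s12; set x := 2 `^ (- s).
have x0 : 0 < x by rewrite powR_gt0.
have x2 : 2 * x ^+ 2 < 1.
  have -> : x ^+ 2 = 2 `^ (- s * 2) by rewrite -powR_mulrn ?powR_ge0// -powRrM.
  have -> : 2 * 2 `^ (- s * 2) = 2 `^ (1 + - s * 2) :> R.
    by rewrite powRD ?powRr1// pnatr_eq0 implybT.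
  rewrite /powR ifN ?pnatr_eq0// -[ltRHS]expR0 ltr_expR.
  by rewrite nmulr_rlt0 ?ln_gt0 ?ltr1n//; lra.
have u0 : 0 < 2 * x ^+ 2 by rewrite mulr_gt0// exprn_gt0.
set u := 2 * x ^+ 2 in x2 u0.
have u10 : 0 < 1 + u by lra.
pose q := Num.sqrt (1 + u)^-1.
have q0 : 0 < q by rewrite sqrtr_gt0 invr_gt0.
have qq : q ^+ 2 = (1 + u)^-1 by rewrite sqr_sqrtr// invr_ge0 ltW.
exists q; split=> //.
- rewrite -(@ltr_sqr R) ?nnegrE ?ler01 ?ltW// qq expr1n invf_lt1//; lra.
- rewrite qq ltr_pdivlMr//; lra.
- rewrite -(@ltr_sqr R) ?nnegrE ?ler01 ?mulr_ge0 ?ltW// expr1n !exprMn qq.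
  rewrite (_ : _ * _ = 2 * u / (1 + u)); last by rewrite /u; field; rewrite gt_eqF.
  by rewrite ltr_pdivrMr//; lra.
Qed.

Context {d : measure_display} {T : measurableType d}.
Variables (P : probability T R) (B : R -> {RV P >-> R}).
Hypothesis hB : standard_brownian_motion B.

Lemma measurable_increment (s t : R) : measurable_fun setT (fun w => B t w - B s w : R).
Proof. exact: (measurable_funP (increment B s t)). Qed.

Lemma measurable_increment_tail (s t l : R) :
  measurable [set w | l < `|B t w - B s w|].
Proof.
rewrite -[X in measurable X]setTI.
exact: (measurable_increment s t measurableT (measurable_normr_gt l)).
Qed.

Lemma increment_tail_le (s t l : R) : 0 <= s -> s < t -> 0 <= l ->
  (P [set w | (l < `|B t w - B s w|)%R] <=
    (2 * expR (- (l ^+ 2 / (4 * (t - s)))))%:E)%E.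
Proof.
move=> s0 st l0.
have := bm_normal_increments hB s0 st (measurable_normr_gt l).
rewrite /distribution/= /pushforward/= => ->.
apply: le_trans (normal_prob_tail_le _ l0) _; first by rewrite sqrtr_gt0 subr_gt0.
by rewrite sqr_sqrtr// subr_ge0 ltW.
Qed.

Lemma closed_ball_measurable (c r : R) : measurable [set x : R | `|x - c| <= r].
Proof. by rewrite normr_sub_le_itv. Qed.

Lemma measurable_increment_ball (t c r : R) :
  measurable [set w | `|B t w - B 0 w - c| <= r].
Proof.
rewrite -[X in measurable X]setTI.
exact: (measurable_increment 0 t measurableT (closed_ball_measurable c r)).
Qed.

(** Stated for [B t - B 0], whose law is prescribed; [B 0 = 0] holds only almost surely and is
    substituted later. *)
Lemma increment_ball_le (t c r : R) : 0 < t -> 0 <= r ->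
  (P [set w | (`|B t w - B 0 w - c| <= r)%R] <= (2 * r / Num.sqrt t)%:E)%E.
Proof.
move=> t0 r0.
have := bm_normal_increments hB (lexx 0) t0 (closed_ball_measurable c r).
rewrite /distribution/= /pushforward/= => ->; rewrite subr0.
by apply: normal_prob_ball_le => //; rewrite sqrtr_gt0.
Qed.

(** For one increment over length [2^(-m)] the tail bound at [q ^+ m] has exponent
    [- (2 * q ^+ 2) ^+ m / 4]. This beats the [N * 2 ^ m] terms of the union bound, so
    Borel-Cantelli applies. *)
Lemma dyadic_increments_ae N (q : R) : 0 < q -> 1 < 2 * q ^+ 2 ->
  {ae P, forall w, exists M, forall m k, (M <= m)%N -> (k < N * 2 ^ m)%N ->
    `|B (dyadic m k.+1) w - B (dyadic m k) w| <= q ^+ m}.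
Proof.
move=> q0 q2; have [C C0 CP] := exp2_mul_expRN_geometric q2.
pose A m k := [set w | q ^+ m < `|B (dyadic m k.+1) w - B (dyadic m k) w|].
pose F m := \big[setU/set0]_(k < N * 2 ^ m) A m k.
have mA m k : measurable (A m k) by exact: measurable_increment_tail.
have mF m : measurable (F m) by exact: bigsetU_measurable.
have PF m : (P (F m) <= (2 * N%:R * C * 2^-1 ^+ m)%:E)%E.
  apply: (le_trans (Boole_inequality P (fun k _ => mA m k))).
  have step k : (P (A m k) <= (2 * expR (- ((2 * q ^+ 2) ^+ m / 4)))%:E)%E.
    apply: (le_trans (increment_tail_le (dyadic_ge0 m k) _ _)).
    - by rewrite dyadic_succ ltrDl invr_gt0 exp2_gt0.
    - by rewrite exprn_ge0// ltW.
    rewrite lee_fin ler_pM2l// ler_expR lerN2 dyadic_succ [X in 4 * X]addrAC subrr add0r.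
    rewrite exprMn exprAC le_eqVlt; apply/orP; left; apply/eqP; field.
    by rewrite gt_eqF// exp2_gt0.
  apply: (le_trans (lee_sum _ (fun (k : 'I_(N * 2 ^ m)) _ => step k))).
  rewrite sumEFin lee_fin sumr_const card_ord -(mulr_natl _ (N * 2 ^ m)) natrM natrX.
  have := CP m; set e := expR _ => CPm.
  rewrite (_ : _ * (2 * e) = 2 * N%:R * (2 ^+ m * e)); last by ring.
  by rewrite -[leRHS]mulrA ler_wpM2l// mulr_ge0.
have : 0 <= 2 * N%:R * C by rewrite !mulr_ge0.
move=> /(@ae_eventually_notin _ _ _ P F _ 2^-1).
have h0 : 0 < 2^-1 :> R by [].
have h1 : 2^-1 < 1 :> R by rewrite invf_lt1 ?ltr1n.
move=> /(_ h0 h1 mF PF); apply: filterS => w [M MP]; exists M => m k Mm kN.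
rewrite leNgt; apply/negP => Aw; apply: (MP m Mm).
by rewrite /F -bigcup_mkord; exists k.
Qed.

(* By the small-ball bound the expected number of counted intervals is
   O((2q)^n), whence the condition on 2qx. *)
Lemma few_close_intervals_ae N (a q x : R) (f : R -> R) (C : R) (v : nat -> nat -> R) :
  0 < a -> 0 < q -> q < 1 -> 1 < 2 * q ^+ 2 -> 0 < x -> 2 * q * x < 1 -> 0 <= C ->
  (forall n k, 0 <= v n k) ->
  (forall n, \sum_(k < N * 2 ^ n) v n k <= C * Num.sqrt 2 ^+ n) ->
  {ae P, forall w, forall e, 0 < e -> exists M, forall n, (M <= n)%N ->
    \sum_(k < N * 2 ^ n) (((a <= dyadic n k) &&
       (`|B (dyadic n k) w - B 0 w - f (dyadic n k)| <= v n k + q ^+ n / (1 - q)))%:R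
       * x ^+ n) < e}.
Proof.
move=> a0 q0 q1 q2 x0 qx1 C0 v0 vC.
have q10 : 0 < 1 - q by rewrite subr_gt0.
pose r n k := v n k + q ^+ n / (1 - q).
have r0 n k : 0 <= r n k by rewrite addr_ge0// divr_ge0 ?exprn_ge0// ltW.
(* Keeping only dyadic points beyond [a] makes the factor [1 / Num.sqrt t] of the small-ball bound
   uniform. *)
pose G n k := if a <= dyadic n k then
  [set w | `|B (dyadic n k) w - B 0 w - f (dyadic n k)| <= r n k] else set0.
have mG n k : measurable (G n k).
  by rewrite /G; case: ifP => // _; exact: measurable_increment_ball.
pose C' := 2 / Num.sqrt a * (C + N%:R / (1 - q)).
have sa0 : 0 < Num.sqrt a by rewrite sqrtr_gt0.
have C'0 : 0 <= C'.
  rewrite /C' mulr_ge0// ?addr_ge0// divr_ge0// ltW//.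
have PG n : (\sum_(k < N * 2 ^ n) P (G n k) <= (C' * (2 * q) ^+ n)%:E)%E.
  have step k : (P (G n k) <= (2 / Num.sqrt a * r n k)%:E)%E.
    rewrite /G; case: ifPn => [adk|_]; last first.
      by rewrite measure0 lee_fin mulr_ge0// divr_ge0// ltW.
    apply: (le_trans (increment_ball_le _ _ (r0 n k))); first exact: lt_le_trans adk.
    rewrite lee_fin [leRHS]mulrAC ler_wpM2l ?mulr_ge0//.
    by rewrite lef_pV2 ?posrE ?sqrtr_gt0 ?(lt_le_trans a0)// ler_wsqrtr.
  apply: (le_trans (lee_sum _ (fun (k : 'I_(N * 2 ^ n)) _ => step k))).
  rewrite sumEFin lee_fin -mulr_sumr /C' -[leRHS]mulrA.
  apply: ler_wpM2l; first by rewrite divr_ge0// ltW.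
  rewrite big_split/= sumr_const card_ord -(mulr_natl _ (N * 2 ^ n)) natrM natrX mulrDl.
  apply: lerD.
    apply: (le_trans (vC n)); rewrite ler_wpM2l//.
    (* Since [(2 * q) ^+ 2 > 2], the growth [Num.sqrt 2 ^+ n] of the oscillation sum is dominated by
       [(2 * q) ^+ n]. *)
    have q20 : 0 <= 2 * q by rewrite mulr_ge0// ltW.
    apply: lerXn2r; rewrite ?nnegrE ?sqrtr_ge0//.
    by rewrite -(ger0_norm q20) -sqrtr_sqr ler_wsqrtr// exprMn; lra.
  rewrite exprMn le_eqVlt; apply/orP; left; apply/eqP; field.
  by rewrite gt_eqF.
(* With the threshold [(y / x) ^+ n] for the count, exceeding it has probability of order
   [(2 * q * x / y) ^+ n], which is summable, and staying below it leaves total size at most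
   [y ^+ n], which tends to 0. *)
have [y qxy y1] : exists2 y, 2 * q * x < y & y < 1.
  by exists ((1 + 2 * q * x) / 2); lra.
have qx0 : 0 < 2 * q * x by rewrite !mulr_gt0.
have y0 : 0 < y by exact: lt_trans qxy.
have l0 n : 0 < (y / x) ^+ n by rewrite exprn_gt0// divr_gt0.
pose H n := [set w | (y / x) ^+ n <= \sum_(k < N * 2 ^ n) (\1_(G n k) w : R)].
have mH n : measurable (H n).
  by have [] := count_markov P (N * 2 ^ n) (ltW (l0 n)) (mG n).
have PH n : (P (H n) <= (C' * (2 * q * x / y) ^+ n)%:E)%E.
  have [_ /le_trans/(_ (PG n))] := count_markov P (N * 2 ^ n) (ltW (l0 n)) (mG n).
  rewrite -/(H n) -(fineK (fin_num_measure P _ (mH n))) -EFinM !lee_fin => h.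
  rewrite [leRHS](_ : _ = (C' * (2 * q) ^+ n) / (y / x) ^+ n).
    by rewrite ler_pdivlMr// mulrC.
  rewrite !exprMn !exprVn; field.
  by rewrite !expf_neq0// gt_eqF.
have z0 : 0 < 2 * q * x / y by rewrite divr_gt0.
have z1 : 2 * q * x / y < 1 by rewrite ltr_pdivrMr// mul1r.
have := ae_eventually_notin C'0 z0 z1 mH PH.
apply: filterS => w [M1 M1P] e e0.
have [M2 M2P] := exprn_eventually_lt (ltW y0) y1 e0.
exists (maxn M1 M2) => n; rewrite geq_max => /andP[M1n M2n].
apply: le_lt_trans (M2P n M2n); rewrite -mulr_suml.
have := M1P n M1n; rewrite /H/= => /negP; rewrite -ltNge => /ltW h.
have -> : y ^+ n = (y / x) ^+ n * x ^+ n.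
  by rewrite -exprMn divfK// gt_eqF.
apply: ler_wpM2r; first by rewrite exprn_ge0// ltW.
apply: le_trans h.
apply: ler_sum => k _; rewrite indicE ler_nat /G; case: ifPn => //= _.
by case: (boolP (_ <= _)) => //= h; rewrite mem_set.
Qed.

End BrownianZeros.

(** Truncating the zero set below keeps the small-ball bound uniform; truncating it above leaves
    finitely many dyadic intervals at each level. *)
Lemma zeros_small_covers_ae (R : realType) (d : measure_display) (T : measurableType d)
    (P : probability T R) (B : R -> {RV P >-> R}) (f : R -> R) (s : R) (p : nat) :
  standard_brownian_motion B ->
  half_hoelder_on_compacts f \/ bounded_variation_on_compacts f -> 2^-1 < s ->
  {ae P, forall w, small_covers s
    (zeros (fun t : R => (B t w - f t)%R) `&` [set t | p.+1%:R^-1 <= t < p.+1%:R])}.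
Proof.
move=> hB hf s12; set N := p.+1.
have [q [q0 q1 q2 qx]] := exists_modulus_exponent s12.
have q10 : 0 < 1 - q by rewrite subr_gt0.
have [C C0 CP] : exists2 C, 0 <= C & forall n, exists v : nat -> R,
  [/\ forall k, 0 <= v k, dyadic_osc_bound f N n v &
      \sum_(k < N * 2 ^ n) v k <= C * Num.sqrt 2 ^+ n].
  by case: hf; [exact: half_hoelder_dyadic_osc|exact: bounded_variation_dyadic_osc].
have [v vP] := choice CP.
(* Half the lower cutoff: once [2^(-n) < a], the dyadic interval of a point [t >= N%:R^-1] starts
   beyond [a]. *)
set a : R := N%:R^-1 / 2.
have a0 : 0 < a by rewrite divr_gt0// invr_gt0 ltr0n.
set x : R := 2 `^ (- s) in qx.
have x0 : 0 < x by rewrite powR_gt0.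
have vn n k : 0 <= v n k by have [] := vP n.
have vs n : \sum_(k < N * 2 ^ n) v n k <= C * Num.sqrt 2 ^+ n by have [] := vP n.
have ae1 := few_close_intervals_ae hB f a0 q0 q1 q2 x0 qx C0 vn vs.
have ae2 := dyadic_increments_ae hB N q0 q2.
have ae3 := bm_continuous_paths hB.
have ae4 := bm_start hB.
near=> w => delta eps delta0 eps0.
have Bw0 : B 0 w = 0 by near: w.
have cB : {within `[0, +oo[, continuous (fun t : R => B t w : R)} by near: w.
have [M1 M1P] : exists M, forall m k, (M <= m)%N -> (k < N * 2 ^ m)%N ->
    `|B (dyadic m k.+1) w - B (dyadic m k) w| <= q ^+ m by near: w.
have [M2 M2P] : exists M, forall n, (M <= n)%N ->
    \sum_(k < N * 2 ^ n) (((a <= dyadic n k) &&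
       (`|B (dyadic n k) w - B 0 w - f (dyadic n k)| <= v n k + q ^+ n / (1 - q)))%:R
       * x ^+ n) < eps.
  by move: {delta delta0} eps eps0; near: w; exact: ae1.
have da0 : 0 < Num.min delta a by rewrite lt_min delta0.
have [M3 M3P] := exp2V_lt da0.
pose n := maxn M1 (maxn M2 M3).
have M1n : (M1 <= n)%N by rewrite leq_maxl.
have M2n : (M2 <= n)%N by rewrite /n maxnCA leq_maxl.
have M3n : (M3 <= n)%N by rewrite /n maxnA leq_maxr.
have : (2 ^+ n)^-1 < Num.min delta a.
  apply: le_lt_trans M3P; rewrite lef_pV2 ?posrE ?exp2_gt0//.
  by rewrite ler_weXn2l// ler1n.
rewrite lt_min => /andP[nd na].
pose sel k := (a <= dyadic n k) &&
  (`|B (dyadic n k) w - B 0 w - f (dyadic n k)| <= v n k + q ^+ n / (1 - q)).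
pose E k : set R := if (k < N * 2 ^ n)%N && sel k
  then [set t | dyadic n k <= t < dyadic n k.+1] else set0.
have Ed k : (diam (E k) <= ((2 ^+ n)^-1)%:E)%E.
  apply: diam_le => t u; rewrite /E; case: ifP => //= _.
  rewrite dyadic_succ => /andP[t1 t2] /andP[u1 u2].
  by rewrite ler_norml; apply/andP; split; lra.
have s0 : 0 <= s by lra.
exists E.
  split=> [k|t [[t0 /eqP]]/=].
    by apply: (le_trans (Ed k)); rewrite lee_fin ltW.
  rewrite subr_eq0 => /eqP Bf /andP[Nt tN].
  pose k := dyadic_index n t; exists k => //.
  have kt := dyadic_indexP n (ltW t0); rewrite -/k in kt.
  have kN : (k < N * 2 ^ n)%N by exact: dyadic_index_lt (ltW t0) tN.
  rewrite /E kN /=; suff -> : sel k by [].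
  apply/andP; split.
    by move: kt; rewrite dyadic_succ => /andP[_]; rewrite /a in na *; lra.
  have := chaining q0 q1 cB M1P M1n (ltW t0) tN; rewrite -/k Bw0 subr0 Bf => h1.
  have [_ /(_ k t kN kt) h2 _] := vP n.
  (* As [B t w = f t], the first difference is an oscillation of [f] and the second one of the path,
     bounded by chaining. *)
  rewrite (_ : _ - _ = (f t - f (dyadic n k)) - (f t - B (dyadic n k) w)); last by ring.
  by apply: (le_trans (ler_normB _ _)); exact: lerD.
apply: (le_trans (@nneseries_diam_pow_le _ s _ (N * 2 ^ n) sel E s0 Ed _)).
  by move=> k; rewrite /E => /negbTE ->.
rewrite lee_fin; apply: le_trans (ltW (M2P n M2n)); apply: ler_sum => k _; rewrite -/(sel k).
rewrite (_ : _ `^ s = x ^+ n)//.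
have -> : (2 ^+ n)^-1 = 2 `^ (- n%:R) :> R by rewrite powRN powR_mulrn.
by rewrite /x -powRrM -powR_mulrn ?powR_ge0// -powRrM mulNr mulNr mulrC.
Unshelve. all: by end_near. Qed.

Theorem theorem1p6 (R : realType) (d : measure_display) (T : measurableType d)
    (P : probability T R) (B : R -> {RV P >-> R}) (f : R -> R)
    (hB : standard_brownian_motion B)
    (hf : half_hoelder_on_compacts f \/ bounded_variation_on_compacts f) :
  {ae P, forall w,
    (hausdorff_dim (zeros (fun t : R => (B t w - f t)%R)) <= (2^-1)%:E)%E}.
Proof.
have h p j : {ae P, forall w, small_covers (2^-1 + j.+1%:R^-1)
    (zeros (fun t : R => (B t w - f t)%R) `&` [set t | p.+1%:R^-1 <= t < p.+1%:R])}.
  by apply: zeros_small_covers_ae => //; rewrite ltrDl invr_gt0 ltr0n.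
(* Countably many pairs [p], [j]: a single null event serves for all of them. *)
have := ae_foralln (fun p => ae_foralln (h p)).
apply: filterS => w hw; apply: hausdorff_dim_le => [|j]; first by rewrite invr_ge0.
apply: hausdorff_measure_small_covers.
have := small_covers_bigcup (fun p => hw p j).
rewrite -setI_bigcupr (_ : \bigcup_p _ = [set t | 0 < t]).
  by rewrite (_ : _ `&` _ = zeros (fun t : R => (B t w - f t)%R))//; apply/seteqP; split => t [].
apply/seteqP; split=> t /=.
  by move=> [p _ /= /andP[+ _]]; apply: lt_le_trans; rewrite invr_gt0 ltr0n.
move=> t0; have [p1] := ltr_add_invr t0; rewrite add0r => tp1.
(* [p1] secures the lower cutoff and [Num.truncn t] the strict upper one. *)
exists (maxn p1 (Num.truncn t)) => //=; apply/andP; split.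
  apply: le_trans (ltW tp1); rewrite lef_pV2 ?posrE ?ltr0n// ler_nat ltnS.
  exact: leq_maxl.
apply: (lt_le_trans (truncnS_gt t)).
by rewrite ler_nat ltnS leq_maxr.
Qed.
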